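(* Let $\mathcal{S}$ be a commutative semiring, let $\Sigma$ be a finite alphabet, and let $f:\Sigma^{\star}\to\mathcal{S}$ be a word function. Then $f\in\mathbf{MSOLEVAL}_{\mathcal{S}}$ if and only if $f$ is recognized by some weighted automaton over $\mathcal{S}$.
   Context: Word structures: a word $w=\sigma_1\cdots\sigma_n\in\Sigma^{\star}$ (with $n=\ell(w)$, $[n]=\{1,\dots,n\}$) is represented by the relational structure $\mathcal{A}_w$ with universe $\{0\}\cup[n]$, the natural linear order $<$, and for each $a\in\Sigma$ a unary predicate $P_a=\{i\in[n]:\sigma_i=a\}$; position $0$ carries no letter. $\mathbf{MSOL}$ denotes monadic second order logic over this vocabulary (possibly extended by further unary relation symbols). $\mathbf{MSOL}$-polynomials are defined inductively. (1) If $\phi(v)$ is an $\mathbf{MSOL}$ formula with a free first-order variable $v$ and $r$ is an indeterminate or a nonzero element of $\mathcal{S}$, then $r^{|\{a: \mathcal{A}\models\phi(a)\}|}$, also written $\prod_{v:\phi(v)} r$, is a monomial; finite products of monomials are monomials. (2) Monomials are $\mathbf{MSOL}$-polynomials. (3) If $\phi(\bar R)$ is an $\mathbf{MSOL}$ formula over the vocabulary extended by a finite tuple $\bar R=(R_1,\dots,R_m)$ of new unary relation symbols, and $t$ is an $\mathbf{MSOL}$-polynomial over the extended vocabulary, then $\sum_{\bar R:\langle\mathcal{A},\bar R\rangle\models\phi(\bar R)} t$ (summing over all tuples of subsets of the universe satisfying $\phi$) is an $\mathbf{MSOL}$-polynomial over the original vocabulary. A word function $f:\Sigma^{\star}\to\mathcal{S}$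 belongs to $\mathbf{MSOLEVAL}_{\mathcal{S}}$ if there is an $\mathbf{MSOL}$-polynomial over the word vocabulary and a substitution of elements of $\mathcal{S}$ for its indeterminates such that, for every word $w$, $f(w)$ is the value of the resulting expression on $\mathcal{A}_w$ (sums and products computed in $\mathcal{S}$). Weighted automata: a weighted automaton $A$ of size $r$ over $\mathcal{S}$ consists of vectors $\alpha,\gamma\in\mathcal{S}^r$ and, for each $\sigma\in\Sigma$, a matrix $\mu_\sigma\in\mathcal{S}^{r\times r}$. It defines $f_A(\sigma_1\cdots\sigma_n)=\alpha\cdot\mu_{\sigma_1}\cdots\mu_{\sigma_n}\cdot\gamma^{T}$. A word function $f$ is recognized by $A$ if $f=f_A$. *)

(* Defs.v *)
From HB Require Import structures.
From mathcomp Require Import all_boot all_order all_algebra.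

Set Implicit Arguments.
Unset Strict Implicit.
Unset Printing Implicit Defensive.

Import GRing.Theory.

(* A vocabulary consists of one binary symbol < and the unary symbols in tau.
   The word vocabulary over Sigma is the case tau := Sigma (the predicates
   P_a), and its extension by k new unary symbols is tau + 'I_k.              *)
Record structure (tau : finType) := Structure {
  universe : finType;
  order_rel : rel universe;
  unary_rel : tau -> {set universe}
}.

Definition expand (tau : finType) (A : structure tau) (k : nat)
    (R : k.-tuple {set universe A}) : structure (tau + 'I_k)%type :=
  @Structure (tau + 'I_k)%type (universe A) (@order_rel tau A)
    (fun s => match s with inl a => unary_rel A a | inr i => tnth R i end).

(* The default value a of nth is never reached: 0 < i <= size w. *)
Definition word_structure (Sigma : finType) (w : seq Sigma) :
    structure Sigma :=
  @Structure Sigma 'I_(size w).+1 (fun i j => (i < j)%N)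
    (fun a => [set i : 'I_(size w).+1 | (0 < i)%N && (nth a w i.-1 == a)]).

(* [msol tau n k]: formulas whose free variables are among n first-order and
   k set variables, as de Bruijn indices; a quantifier binds index 0. The
   other connectives and quantifiers are the usual classical abbreviations.   *)
Inductive msol (tau : finType) : nat -> nat -> Type :=
| MLt n k (x y : 'I_n) : msol tau n k
| MEq n k (x y : 'I_n) : msol tau n k
| MPred n k (a : tau) (x : 'I_n) : msol tau n k
| MMem n k (x : 'I_n) (X : 'I_k) : msol tau n k
| MNot n k (phi : msol tau n k) : msol tau n k
| MAnd n k (phi psi : msol tau n k) : msol tau n k
| MEx1 n k (phi : msol tau n.+1 k) : msol tau n k
| MEx2 n k (phi : msol tau n k.+1) : msol tau n k.

Fixpoint sat (tau : finType) (A : structure tau) (n k : nat)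
    (phi : msol tau n k) {struct phi} :
    n.-tuple (universe A) -> k.-tuple {set universe A} -> bool :=
  match phi in msol _ n k
    return n.-tuple (universe A) -> k.-tuple {set universe A} -> bool with
  | MLt _ _ x y => fun e _ => order_rel (tnth e x) (tnth e y)
  | MEq _ _ x y => fun e _ => tnth e x == tnth e y
  | MPred _ _ a x => fun e _ => tnth e x \in unary_rel A a
  | MMem _ _ x X => fun e E => tnth e x \in tnth E X
  | MNot _ _ phi1 => fun e E => ~~ sat phi1 e E
  | MAnd _ _ phi1 phi2 => fun e E => sat phi1 e E && sat phi2 e E
  | MEx1 _ _ phi1 => fun e E =>
      [exists a : universe A, sat phi1 [tuple of a :: e] E]
  | MEx2 _ _ phi1 => fun e E =>
      [exists B : {set universe A}, sat phi1 e [tuple of B :: E]]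
  end.

Arguments sat [tau] A [n k] phi _ _.

Definition models (tau : finType) (A : structure tau) (phi : msol tau 0 0) :
  bool := sat A phi [tuple] [tuple].

Definition def_set (tau : finType) (A : structure tau) (phi : msol tau 1 0) :
  {set universe A} := [set a | sat A phi [tuple a] [tuple]].

Variant coefficient (S : comPzSemiRingType) :=
| Indeterminate (i : nat)
| Constant (c : S) of c != 0%R.

Inductive monomial (S : comPzSemiRingType) (tau : finType) :=
| MonoPow (r : coefficient S) (phi : msol tau 1 0)
| MonoMul (m1 m2 : monomial S tau).

Inductive msol_poly (S : comPzSemiRingType) (tau : finType) : Type :=
| PMono (m : monomial S tau)
| PSum (k : nat) (phi : msol (tau + 'I_k)%type 0 0)
       (t : msol_poly S (tau + 'I_k)%type).

Local Open Scope ring_scope.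

Section Evaluation.

Variables (S : comPzSemiRingType) (rho : nat -> S).

Definition eval_coefficient (r : coefficient S) : S :=
  match r with Indeterminate i => rho i | Constant c _ => c end.

Fixpoint eval_monomial (tau : finType) (A : structure tau)
    (m : monomial S tau) : S :=
  match m with
  | MonoPow r phi => eval_coefficient r ^+ #|def_set A phi|
  | MonoMul m1 m2 => eval_monomial A m1 * eval_monomial A m2
  end.

Fixpoint eval_poly (tau : finType) (A : structure tau)
    (t : msol_poly S tau) {struct t} : S :=
  match t with
  | PMono m => eval_monomial A m
  | PSum k phi t1 =>
      \sum_(R : k.-tuple {set universe A} | models (expand R) phi)
        eval_poly (expand R) t1
  end.

End Evaluation.

Definition MSOLEVAL (S : comPzSemiRingType) (Sigma : finType)
    (f : seq Sigma -> S) : Prop :=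
  exists (t : msol_poly S Sigma) (rho : nat -> S),
    forall w : seq Sigma, f w = eval_poly rho (word_structure w) t.

Record weighted_automaton (S : comPzSemiRingType) (Sigma : finType)
    (r : nat) := WeightedAutomaton {
  wa_initial : 'rV[S]_r;
  wa_final : 'rV[S]_r;
  wa_matrix : Sigma -> 'M[S]_r
}.

Definition wa_fun (S : comPzSemiRingType) (Sigma : finType) (r : nat)
    (A : weighted_automaton S Sigma r) (w : seq Sigma) : S :=
  (wa_initial A *m (\big[mulmx/1%:M]_(s <- w) wa_matrix A s)
     *m (wa_final A)^T) ord0 ord0.

Definition recognized_by (S : comPzSemiRingType) (Sigma : finType) (r : nat)
    (f : seq Sigma -> S) (A : weighted_automaton S Sigma r) : Prop :=
  forall w : seq Sigma, f w = wa_fun A w.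

(* Main.v *)
Require Import Defs.
From HB Require Import structures.
From mathcomp Require Import all_boot all_order all_algebra.

(** An assignment of subsets of ['I_N] to a finite set [T] of tracks is a word
    of length [N] over the alphabet [{set T}]. As in Buechi's theorem, the truth
    of an MSOL formula is a regular property of the word of its free variables,
    a first-order variable being a singleton track. The series recognized by
    weighted automata contain the characteristic series of regular languages
    and are closed under Hadamard product (the semiring is commutative) and
    under summation over the words with a given letterwise image. A sum over
    set variables is such a summation, and [r ^ |{a : phi a}|] is the sum of
    [r ^ |X|] over the only [X] equal to [{a : phi a}]; hence every
    MSOL-polynomial is recognized.

    Conversely, the value of a weighted automaton is the sum of the weights of
    its paths. A path is a partition of the positions [0 .. n] indexed by the
    states, and its weight is a product of monomials counting the positions of
    each local shape: first, last, or transition. *)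

Set Implicit Arguments.
Unset Strict Implicit.
Unset Printing Implicit Defensive.

Import GRing.Theory.

(** * Regular languages and MSOL *)

Section Lifts.

Variables (A B : finType) (h : B -> A).

(** The fibre of the letterwise map over [w] is kept as a duplicate-free list, so that existential
    projection is [has] over it and summation is a big operator over it. *)
Fixpoint lifts (w : seq A) : seq (seq B) :=
  if w is a :: w' then
    [seq b :: u | b <- enum [pred b | h b == a], u <- lifts w']
  else [:: [::]].

Lemma mem_lifts w u : (u \in lifts w) = (map h u == w).
Proof.
elim: w u => [|a w IHw] [|b u] //=.
  by apply/negP => /allpairsP [p [_ _]].
rewrite eqseq_cons; apply/allpairsP/andP.
  move=> [[b' u'] /= [hb hu [-> ->]]].
  by move: hb; rewrite mem_enum -IHw.
move=> [hb hu].
by exists (b, u); rewrite /= mem_enum IHw.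
Qed.

Lemma lifts_uniq w : uniq (lifts w).
Proof.
elim: w => //= a w IHw; apply: allpairs_uniq => //; first exact: enum_uniq.
by move=> [b u] [b' u'] _ _ [-> ->].
Qed.

End Lifts.

(* Automata read words from right to left, so that runs are structural
   recursions on words. *)
Definition regular (B : finType) (L : seq B -> bool) : Prop :=
  exists (Q : finType) (d : B -> Q -> Q) (q0 : Q) (F : pred Q),
    forall w, L w = F (foldr d q0 w).

Lemma regular_not (B : finType) (L : seq B -> bool) :
  regular L -> regular (fun w => ~~ L w).
Proof.
move=> [Q [d [q0 [F hL]]]]; exists Q, d, q0, (fun q => ~~ F q) => w.
by rewrite hL.
Qed.

Lemma regular_op (B : finType) (op : bool -> bool -> bool)
    (L1 L2 : seq B -> bool) :
  regular L1 -> regular L2 -> regular (fun w => op (L1 w) (L2 w)).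
Proof.
move=> [Q1 [d1 [q1 [F1 hL1]]]] [Q2 [d2 [q2 [F2 hL2]]]].
exists (Q1 * Q2)%type, (fun b q => (d1 b q.1, d2 b q.2)), (q1, q2),
  (fun q => op (F1 q.1) (F2 q.2)) => w.
rewrite hL1 hL2; suff -> : foldr (fun b q => (d1 b q.1, d2 b q.2)) (q1, q2) w
  = (foldr d1 q1 w, foldr d2 q2 w) by [].
by elim: w => //= b w ->.
Qed.

Lemma regular_has (B : finType) (p : pred B) : regular (has p).
Proof.
exists bool, (fun b s => p b || s), false, id => w.
by elim: w => //= b w ->.
Qed.

Lemma regular_pairwise (B : finType) (p q : pred B) :
  regular (pairwise (fun l m => ~~ (p l && q m))).
Proof.
(* The first bit records whether the suffix read so far has a [q]-letter, the second whether it
   contains no forbidden pair. *)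
pose d b s := (q b || s.1, ~~ (p b && s.1) && s.2).
exists (bool * bool)%type, d, (false, true), snd => w.
suff -> : foldr d (false, true) w
  = (has q w, pairwise (fun l m => ~~ (p l && q m)) w) by [].
elim: w => //= b w -> /=; congr (_, _ && _).
by case: (p b) => /=; rewrite ?has_predC -?all_predC //; apply/esym/allP.
Qed.

(** Subset construction: after reading [w], the new state is the set of states that the old
    automaton reaches on the lifts of [w]. *)
Lemma regular_project (A B : finType) (h : B -> A) (L : seq B -> bool) :
  regular L -> regular (fun w => has L (lifts h w)).
Proof.
move=> [Q [d [q0 [F hL]]]].
pose d' a (s : {set Q}) :=
  [set d x.1 x.2 | x : B * Q & (h x.1 == a) && (x.2 \in s)].
exists {set Q}, d', [set q0], (fun s : {set Q} => [exists q in s, F q]) => w.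
have mem_run q : reflect (exists2 u, u \in lifts h w & q = foldr d q0 u)
                         (q \in foldr d' [set q0] w).
  apply: (iffP idP).
    elim: w q => [|a w IHw] q /=.
      by rewrite inE => /eqP ->; exists [::].
    move=> /imsetP [[b p]]; rewrite inE /= => /andP [/eqP hb /IHw [u hu ->]] ->.
    exists (b :: u) => //; rewrite (mem_lifts h (a :: w)) /= hb.
    by rewrite eqseq_cons eqxx -mem_lifts.
  move=> [u hu ->]; elim: w u hu => [|a w IHw] [|b u] /=.
  - by rewrite inE.
  - by [].
  - by move=> /allpairsP [p [_ _]].
  rewrite (mem_lifts h (a :: w)) /= eqseq_cons -mem_lifts => /andP [hb hu].
  by apply/imsetP; exists (b, foldr d q0 u) => //; rewrite inE hb /= IHw.
apply/hasP/exists_inP => [[u hu Lu]|[q /mem_run [u hu ->] hq]].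
  by exists (foldr d q0 u); rewrite -?hL //; apply/mem_run; exists u.
by exists u; rewrite ?hL.
Qed.

(** * Assignments of sets as words *)

Definition enc (T : finType) (N : nat) (V : T -> {set 'I_N}) : seq {set T} :=
  [seq [set t | i \in V t] | i <- enum 'I_N].

Lemma size_enc (T : finType) N (V : T -> {set 'I_N}) : size (enc V) = N.
Proof. by rewrite size_map size_enum_ord. Qed.

Lemma nth_enc (T : finType) N (V : T -> {set 'I_N}) x0 (i : 'I_N) :
  nth x0 (enc V) i = [set t | i \in V t].
Proof. by rewrite (nth_map i) ?size_enum_ord // nth_ord_enum. Qed.

Lemma enc_ext (T : finType) N (V V' : T -> {set 'I_N}) :
  V =1 V' -> enc V = enc V'.
Proof.
by move=> eqV; apply: eq_map => i; apply/setP => t; rewrite !inE eqV.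
Qed.

Lemma enc_inj (T : finType) N (V V' : T -> {set 'I_N}) :
  enc V = enc V' -> V =1 V'.
Proof.
move=> eqV t; apply/setP => i.
have /setP/(_ t) := congr1 (fun s => nth set0 s i) eqV.
by rewrite !nth_enc !inE.
Qed.

Lemma enc_surj (T : finType) N (u : seq {set T}) :
  size u = N -> exists V : T -> {set 'I_N}, u = enc V.
Proof.
move=> su; exists (fun t => [set i : 'I_N | t \in nth set0 u i]).
apply: (@eq_from_nth _ set0); rewrite ?size_enc // su => i ltiN.
by rewrite (nth_enc _ _ (Ordinal ltiN)); apply/setP => t; rewrite !inE.
Qed.

Lemma has_enc (T : finType) N (V : T -> {set 'I_N}) (p : pred {set T}) :
  has p (enc V) = [exists i, p [set t | i \in V t]].
Proof.
rewrite has_map; apply/hasP/existsP => [[i _ hi]|[i hi]]; exists i => //.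
exact: mem_enum.
Qed.

Lemma pairwise_enc (T : finType) N (V : T -> {set 'I_N}) (r : rel {set T}) :
  pairwise r (enc V) =
  [forall i : 'I_N, forall j : 'I_N,
     (i < j) ==> r [set t | i \in V t] [set t | j \in V t]].
Proof.
apply/(pairwiseP set0)/forallP => [hr i|hr i j].
  apply/forallP => j; apply/implyP => ltij.
  by rewrite -(nth_enc V set0 i) -(nth_enc V set0 j) hr // inE size_enc.
rewrite !inE size_enc => iN jN ltij.
rewrite (nth_enc V set0 (Ordinal iN)) (nth_enc V set0 (Ordinal jN)).
by have /forallP/(_ (Ordinal jN))/implyP := hr (Ordinal iN); apply.
Qed.

Definition restrict (T T' : finType) (f : T -> T') (s : {set T'}) : {set T} :=
  f @^-1: s.

(** The hypotheses say that [F] parametrizes, without repetition and up to pointwise equality, the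
    assignments extending [V] along [f]. A permutation of lists serves both quantifiers and sums
    over lifts. *)
Lemma lifts_enc (T T' : finType) (f : T -> T') N (V : T -> {set 'I_N})
    (I : finType) (F : I -> T' -> {set 'I_N}) :
    (forall R t, F R (f t) = V t) ->
    (forall R R', F R =1 F R' -> R = R') ->
    (forall V', (forall t, V' (f t) = V t) -> exists R, V' =1 F R) ->
  perm_eq (lifts (restrict f) (enc V)) [seq enc (F R) | R : I].
Proof.
move=> FV Finj Fsurj; apply: uniq_perm; first exact: lifts_uniq.
  by rewrite map_inj_uniq ?enum_uniq // => R R' /enc_inj /Finj.
have mapE V' : map (restrict f) (enc V') = enc (V' \o f).
  by rewrite /enc -map_comp; apply: eq_map => i; apply/setP => t; rewrite !inE.
move=> u; rewrite mem_lifts; apply/eqP/mapP => [hu|[R _ ->]].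
  have su : size u = N by rewrite -(size_map (restrict f)) hu size_enc.
  have [V' eqV'] := enc_surj su; move: hu; rewrite eqV' mapE => /enc_inj /Fsurj.
  by move=> [R eqR]; exists R; [exact: mem_enum|exact: enc_ext].
by rewrite mapE; apply: enc_ext => t /=; rewrite FV.
Qed.

Definition add_track (T : finType) N (X : {set 'I_N}) (V : T -> {set 'I_N})
    (o : option T) : {set 'I_N} := if o is Some t then V t else X.

Lemma lifts_add_track (T : finType) N (V : T -> {set 'I_N}) :
  perm_eq (lifts (restrict Some) (enc V))
          [seq enc (add_track X V) | X : {set 'I_N}].
Proof.
apply: lifts_enc => // [R R' /(_ None) //|V' eqV].
by exists (V' None) => -[t|] /=.
Qed.

Lemma regular_ex2 (T : finType) (L : seq {set option T} -> bool) :
  regular L -> exists2 L', regular L' & forall N (V : T -> {set 'I_N}),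
    L' (enc V) = [exists X, L (enc (add_track X V))].
Proof.
move=> regL; eexists; first exact: (regular_project (restrict Some) regL).
move=> N V /=; rewrite (perm_has _ (lifts_add_track V)) has_map.
apply/hasP/existsP => [[X _ hX]|[X hX]]; exists X => //.
exact: mem_enum.
Qed.

(** First-order quantification is set quantification relativized to singletons: the new track must
    occur in some letter and never at two positions. *)
Lemma regular_ex1 (T : finType) (L : seq {set option T} -> bool) :
  regular L -> exists2 L', regular L' & forall N (V : T -> {set 'I_N}),
    L' (enc V) = [exists a, L (enc (add_track [set a] V))].
Proof.
move=> regL; pose p := [pred l : {set option T} | None \in l].
have reg1 := regular_op andb (regular_has p) (regular_pairwise p p).
have [L' regL' eL'] := regular_ex2 (regular_op andb reg1 regL).
exists L' => // N V; rewrite eL'.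
apply/existsP/existsP => [[X]|[a La]].
  rewrite has_enc pairwise_enc => /andP [/andP [/existsP [a]]].
  rewrite !inE /= => Xa /forallP X1 LX; exists a; suff <- : X = [set a] by [].
  apply/setP => b; rewrite inE; apply/idP/eqP => [Xb|-> //].
  have X1' i j : i \in X -> j \in X -> ~~ (i < j).
    move=> Xi Xj; apply/negP => ltij; have /forallP/(_ j) := X1 i.
    by rewrite ltij !inE /= Xi Xj.
  by apply/val_inj/eqP; rewrite eqn_leq leqNgt X1' //= leqNgt X1'.
exists [set a]; rewrite La andbT has_enc pairwise_enc; apply/andP; split.
  by apply/existsP; exists a; rewrite /= !inE.
apply/forallP => i; apply/forallP => j; apply/implyP; rewrite /= !inE.
by apply: contraTN => /andP [/eqP -> /eqP ->]; rewrite ltnn.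
Qed.

Definition ord_struct (tau : finType) N (P : tau -> {set 'I_N}) :
    structure tau :=
  @Structure tau 'I_N (fun i j => (i < j)%N) P.

(* Generalizing over the track type T makes the quantifier cases go through:
   the bound variable becomes the new track None of option T. *)
Lemma sat_regular (tau : finType) n k (phi : msol tau n k) :
  forall (T : finType) (p : tau -> T) (x : n.-tuple T) (X : k.-tuple T),
  exists2 L, regular L &
  forall N (V : T -> {set 'I_N}) (P : tau -> {set 'I_N})
    (e : n.-tuple 'I_N) (E : k.-tuple {set 'I_N}),
    (forall a, P a = V (p a)) ->
    (forall i, V (tnth x i) = [set tnth e i]) ->
    (forall j, V (tnth X j) = tnth E j) ->
  sat (ord_struct P) phi e E = L (enc V).
Proof.
elim: phi => {n k}.
- move=> n k i j T p x X; pose q y := [pred l : {set T} | y \in l].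
  (* Both tracks are singletons, so the order atom says that some letter containing the first track
     precedes one containing the second; [pairwise] expresses the opposite. *)
  exists (fun w => ~~ pairwise
    (fun l m => ~~ (q (tnth x i) l && q (tnth x j) m)) w).
    exact/regular_not/regular_pairwise.
  move=> N V P e E eP eV eE /=; rewrite pairwise_enc.
  apply/idP/idP => [lt_ij|].
    apply/negP => /forallP/(_ (tnth e i))/forallP/(_ (tnth e j)).
    by rewrite lt_ij !inE !eV !inE !eqxx.
  rewrite negb_forall => /existsP [a]; rewrite negb_forall => /existsP [b].
  by rewrite negb_imply negbK !inE !eV !inE => /and3P [? /eqP <- /eqP <-].
- move=> n k i j T p x X.
  exists (has [pred l : {set T} | (tnth x i \in l) && (tnth x j \in l)]).
    exact: regular_has.
  move=> N V P e E eP eV eE /=; rewrite has_enc.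
  apply/eqP/existsP => [eq_ij|[a]].
    by exists (tnth e i); rewrite /= !inE !eV !inE eq_ij eqxx.
  by rewrite /= !inE !eV !inE => /andP [/eqP <- /eqP <-].
- move=> n k a i T p x X.
  exists (has [pred l : {set T} | (tnth x i \in l) && (p a \in l)]).
    exact: regular_has.
  move=> N V P e E eP eV eE /=; rewrite has_enc.
  apply/idP/existsP => [ai|[b]].
    by exists (tnth e i); rewrite /= !inE !eV !inE eqxx -eP.
  by rewrite /= !inE !eV !inE -eP => /andP [/eqP <-].
- move=> n k i j T p x X.
  exists (has [pred l : {set T} | (tnth x i \in l) && (tnth X j \in l)]).
    exact: regular_has.
  move=> N V P e E eP eV eE /=; rewrite has_enc.
  apply/idP/existsP => [ai|[b]].
    by exists (tnth e i); rewrite /= !inE !eV !inE eqxx eE.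
  by rewrite /= !inE !eV !inE eE => /andP [/eqP <-].
- move=> n k phi IH T p x X; have [L regL eL] := IH T p x X.
  exists (fun w => ~~ L w); first exact: regular_not.
  by move=> N V P e E eP eV eE /=; rewrite (eL _ V).
- move=> n k phi IHphi psi IHpsi T p x X.
  have [L1 reg1 eL1] := IHphi T p x X; have [L2 reg2 eL2] := IHpsi T p x X.
  exists (fun w => L1 w && L2 w); first exact: regular_op.
  by move=> N V P e E eP eV eE /=; rewrite (eL1 _ V) // (eL2 _ V).
- move=> n k phi IH T p x X.
  have [L0 reg0 eL0] := IH (option T) (Some \o p)
    [tuple of None :: map Some x] (map_tuple Some X).
  have [L regL eL] := regular_ex1 reg0; exists L => //.
  move=> N V P e E eP eV eE /=; rewrite eL; apply: eq_existsb => a.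
  apply: eL0 => // [i|j]; last by rewrite tnth_map /= eE.
  case: (unliftP ord0 i) => [i'|] ->; rewrite ?tnth0 //.
  by rewrite !tnthS tnth_map /= eV.
- move=> n k phi IH T p x X.
  have [L0 reg0 eL0] := IH (option T) (Some \o p)
    (map_tuple Some x) [tuple of None :: map Some X].
  have [L regL eL] := regular_ex2 reg0; exists L => //.
  move=> N V P e E eP eV eE /=; rewrite eL; apply: eq_existsb => B.
  apply: eL0 => // [i|j]; first by rewrite tnth_map /= eV.
  case: (unliftP ord0 j) => [j'|] ->; rewrite ?tnth0 //.
  by rewrite !tnthS tnth_map /= eE.
Qed.

(** * Recognizable series and MSOL-polynomials *)

Local Open Scope ring_scope.

Section Recognizable.

Variable S : comPzSemiRingType.

(** The product of the matrices of the letters of [w], applied to the column vector [c]. States form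
    an arbitrary finite type, so that pairs of states are again states. *)
Definition wrun (B Q : finType) (M : B -> Q -> Q -> S) (c : Q -> S)
    (w : seq B) : Q -> S :=
  foldr (fun b v q => \sum_p M b q p * v p) c w.

Definition recognizable (B : finType) (g : seq B -> S) : Prop :=
  exists (Q : finType) (a c : Q -> S) (M : B -> Q -> Q -> S),
    forall w, g w = \sum_q a q * wrun M c w q.

Lemma recognizable_regular (B : finType) (L : seq B -> bool) :
  regular L -> recognizable (fun w => (L w)%:R).
Proof.
move=> [Q [d [q0 [F hL]]]].
(* Deterministic runs go from right to left: acceptance gives the row vector and the start state the
   column vector. *)
exists Q, (fun q => (F q)%:R), (fun q => (q == q0)%:R),
  (fun b q p => (q == d b p)%:R) => w; rewrite hL.
have runE q : wrun (fun b q p => (q == d b p)%:R) (fun q => (q == q0)%:R) w q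
    = (q == foldr d q0 w)%:R :> S.
  elim: w q => //= b w IHw q.
  rewrite (bigD1 (foldr d q0 w)) //= IHw eqxx mulr1 big1 ?addr0 // => p neq.
  by rewrite IHw (negPf neq) mulr0.
rewrite (bigD1 (foldr d q0 w)) //= runE eqxx mulr1 big1 ?addr0 // => q neq.
by rewrite runE (negPf neq) mulr0.
Qed.

(** Kronecker product of the two representations; commutativity of [S] lets the factors be
    regrouped. *)
Lemma recognizable_mul (B : finType) (g1 g2 : seq B -> S) :
  recognizable g1 -> recognizable g2 -> recognizable (fun w => g1 w * g2 w).
Proof.
move=> [Q1 [a1 [c1 [M1 hg1]]]] [Q2 [a2 [c2 [M2 hg2]]]].
pose c (q : Q1 * Q2) := c1 q.1 * c2 q.2.
pose M b (q p : Q1 * Q2) := M1 b q.1 p.1 * M2 b q.2 p.2.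
exists (Q1 * Q2)%type, (fun q => a1 q.1 * a2 q.2), c, M => w.
have runE q : wrun M c w q = wrun M1 c1 w q.1 * wrun M2 c2 w q.2.
  elim: w q => //= b w IHw q.
  rewrite big_distrlr pair_bigA; apply: eq_bigr => p _ /=.
  by rewrite IHw mulrACA.
rewrite hg1 hg2 big_distrlr pair_bigA; apply: eq_bigr => q _ /=.
by rewrite runE mulrACA.
Qed.

Lemma recognizable_prod_letters (B : finType) (c : B -> S) :
  recognizable (fun w => \prod_(b <- w) c b).
Proof.
exists unit, (fun _ => 1), (fun _ => 1), (fun b _ _ => c b) => w.
have sum_unit (F : unit -> S) : \sum_q F q = F tt.
  by rewrite (bigD1 tt) //= big1 ?addr0 // => -[].
rewrite sum_unit mul1r; elim: w => [|b w IHw] /=; first by rewrite big_nil.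
by rewrite big_cons sum_unit IHw.
Qed.

(** By distributivity, it suffices to take as matrix of a letter the sum of the matrices of its
    preimages. *)
Lemma recognizable_project (A B : finType) (h : B -> A) (g : seq B -> S) :
  recognizable g -> recognizable (fun w => \sum_(u <- lifts h w) g u).
Proof.
move=> [Q [a [c [M hg]]]].
pose M' x q p := \sum_(b | h b == x) M b q p.
exists Q, a, c, M' => w.
have runE q : wrun M' c w q = \sum_(u <- lifts h w) wrun M c u q.
  elim: w q => [|x w IHw] q /=; first by rewrite big_seq1.
  rewrite big_allpairs_dep big_enum_cond /=.
  under [RHS]eq_bigr => b _ do rewrite exchange_big /=.
  rewrite exchange_big /=; apply: eq_bigr => p _.
  rewrite IHw big_distrlr /=.
  by apply: eq_bigl => b; rewrite andbT.
under eq_bigr => u _ do rewrite hg.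
rewrite exchange_big /=; apply: eq_bigr => q _.
by rewrite runE big_distrr.
Qed.

End Recognizable.

(** * Values of MSOL-polynomials as recognizable series *)

Section PolyRecognizable.

Variables (S : comPzSemiRingType) (rho : nat -> S).

Lemma pow_recognizable (tau : finType) (c : S) (phi : msol tau 1 0) :
  exists2 g : seq {set tau} -> S, recognizable g &
  forall N (P : tau -> {set 'I_N}),
    c ^+ #|def_set (ord_struct P) phi| = g (enc P).
Proof.
have [L0 reg0 eL0] := sat_regular phi (Some \o Some)
  [tuple (None : option (option tau))] [tuple].
(* Track [None] is the point [a], track [Some None] the set [X]. The language [L1] below says that
   membership in [X] and truth of [phi] disagree at some [a], so its complement defines [X = D]. *)
pose here := [pred l : {set option (option tau)} |
  (None \in l) && (Some None \in l)].
have [L1 reg1 eL1] := regular_ex1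
  (regular_op (fun b1 b2 => b1 (+) b2) reg0 (regular_has here)).
pose weight (l : {set option tau}) := if None \in l then c else 1.
eexists; first exact: (recognizable_project (restrict Some)
  (recognizable_mul (recognizable_regular S (regular_not reg1))
                    (recognizable_prod_letters weight))).
move=> N P /=; set D := def_set _ _.
rewrite (perm_big _ (lifts_add_track P)) /= big_map big_enum /=.
have L1E X : ~~ L1 (enc (add_track X P)) = (X == D).
  rewrite eL1 negb_exists.
  have agreeE a : ~~ (L0 (enc (add_track [set a] (add_track X P))) (+)
      has here (enc (add_track [set a] (add_track X P)))) =
      ((a \in X) == (a \in D)).
    rewrite -(eL0 _ _ P [tuple a] [tuple]) //; last 2 first.
    - by move=> i; rewrite ord1 !tnth0.
    - by case.
    rewrite negb_add has_enc eq_sym [a \in D]inE; congr (_ == _).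
    apply/existsP/idP => [[b]|Xa]; first by rewrite /= !inE => /andP [/eqP <-].
    by exists a; rewrite /= !inE eqxx.
  apply/forallP/eqP => [h|eqX a]; last by rewrite agreeE eqX.
  by apply/setP => a; apply/eqP; rewrite -agreeE.
(* The sum over [X] collapses to the term [X = D], whose letter weights multiply to the required
   power of [c]. *)
rewrite (bigD1 D) //= L1E eqxx mul1r [X in _ + X]big1 ?addr0; last first.
  by move=> X neqX; rewrite L1E (negPf neqX) mul0r.
rewrite big_map big_enum /= -big_mkcondr /=.
rewrite -prodr_const; apply: eq_big => // i.
by rewrite [RHS]inE.
Qed.

Lemma monomial_recognizable (tau : finType) (m : monomial S tau) :
  exists2 g : seq {set tau} -> S, recognizable g &
  forall N (P : tau -> {set 'I_N}),
    eval_monomial rho (ord_struct P) m = g (enc P).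
Proof.
elim: m => [r phi|m1 [g1 rec1 e1] m2 [g2 rec2 e2]] /=.
  exact: pow_recognizable.
exists (fun w => g1 w * g2 w); first exact: recognizable_mul.
by move=> N P; rewrite e1 e2.
Qed.

(** Induction with varying vocabulary: a sum over the [R] satisfying [phi] is the projection,
    forgetting the tracks of [R], of the inner series multiplied by the characteristic series of
    [phi]. *)
Lemma poly_recognizable (tau : finType) (t : msol_poly S tau) :
  exists2 g : seq {set tau} -> S, recognizable g &
  forall N (P : tau -> {set 'I_N}),
    eval_poly rho (ord_struct P) t = g (enc P).
Proof.
elim: t => {}tau => [m|k phi t [g recg eg]].
  exact: monomial_recognizable.
have [L regL eL] := sat_regular phi id [tuple] [tuple].
eexists; first exact: (recognizable_project (restrict inl)
  (recognizable_mul (recognizable_regular S regL) recg)).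
move=> N P /=.
pose F (R : k.-tuple {set 'I_N}) (s : tau + 'I_k) :=
  match s with inl a => P a | inr i => tnth R i end.
have perm_lifts : perm_eq (lifts (restrict inl) (enc P))
    [seq enc (F R) | R : k.-tuple {set 'I_N}].
  apply: lifts_enc => // [R R' eqR|V eqV].
    by apply: eq_from_tnth => i; apply: (eqR (inr i)).
  exists [tuple V (inr i) | i < k] => -[a|i] /=; first exact: eqV.
  by rewrite tnth_mktuple.
rewrite (perm_big _ perm_lifts) /= big_map big_enum /= big_mkcond /=.
apply: eq_bigr => R _.
have -> : models (expand (A := ord_struct P) R) phi = L (enc (F R)).
  by apply: eL => // -[].
rewrite -[eval_poly _ _ _]/(eval_poly rho (ord_struct (F R)) t) eg.
by case: (L _); rewrite ?mul1r ?mul0r.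
Qed.

End PolyRecognizable.

(** * From recognizable series to weighted automata *)

Lemma enc_word_structure (Sigma : finType) (w : seq Sigma) :
  enc (@unary_rel _ (word_structure w)) =
  set0 :: [seq [set s] | s <- w].
Proof.
apply: (@eq_from_nth _ set0); first by rewrite size_enc /= size_map.
rewrite size_enc => -[|i] ltiw.
  rewrite (nth_enc _ _ (Ordinal ltiw)) /=.
  by apply/setP => a; rewrite !inE.
rewrite (nth_enc _ _ (Ordinal ltiw)) /=; apply/setP => a; rewrite !inE /=.
by rewrite (nth_map a) // inE eq_sym.
Qed.

Lemma recognizable_automaton (S : comPzSemiRingType) (Sigma : finType)
    (g : seq Sigma -> S) :
  recognizable g ->
  exists (r : nat) (A : weighted_automaton S Sigma r), recognized_by g A.
Proof.
move=> [Q [a [c [M hg]]]].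
exists #|Q|, (@WeightedAutomaton S Sigma #|Q|
  (\row_i a (enum_val i)) (\row_i c (enum_val i))
  (fun s => \matrix_(i, j) M s (enum_val i) (enum_val j))) => w.
rewrite hg /wa_fun /= -mulmxA mxE (reindex _ (onW_bij _ (@enum_val_bij Q))) /=.
apply: eq_bigr => i _; rewrite mxE; congr (_ * _).
elim: w i => [|s w IHw] i /=.
  by rewrite big_nil mul1mx !mxE.
rewrite big_cons -mulmxA mxE [LHS](reindex _ (onW_bij _ (@enum_val_bij Q))) /=.
by apply: eq_bigr => j _; rewrite mxE IHw.
Qed.

Lemma msoleval_automaton (S : comPzSemiRingType) (Sigma : finType)
    (f : seq Sigma -> S) :
  MSOLEVAL f ->
  exists (r : nat) (A : weighted_automaton S Sigma r), recognized_by f A.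
Proof.
move=> [t [rho hf]]; apply: recognizable_automaton.
have [g [Q [a [c [M hg]]]] eg] := poly_recognizable rho t.
(* Position 0 always reads [set0], so its matrix is absorbed into the initial vector; a letter [s]
   is read as the singleton of [s]. *)
exists Q, (fun q => \sum_p a p * M set0 p q), c, (fun s => M [set s]) => w.
rewrite hf -[word_structure w]/(ord_struct (unary_rel (word_structure w))).
rewrite eg enc_word_structure hg /=.
under eq_bigr => p _ do rewrite big_distrr /=.
rewrite exchange_big /=; apply: eq_bigr => q _.
rewrite big_distrl /=; apply: eq_bigr => p _.
rewrite mulrA; congr (_ * _).
by elim: w q {hf eg} => //= s w IHw q; apply: eq_bigr => x _; rewrite IHw.
Qed.

(** * From automata to MSOL-polynomials *)

Section AutomatonPaths.

Variable S : comPzSemiRingType.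

Lemma sum_tuple_cons (T : finType) n (F : n.+1.-tuple T -> S) :
  \sum_s F s = \sum_x \sum_(u : n.-tuple T) F [tuple of x :: u].
Proof.
pose h (p : T * n.-tuple T) := [tuple of p.1 :: p.2].
rewrite pair_bigA /= (reindex h) //=.
exists (fun s => (thead s, [tuple of behead s])) => [[x u]|s] _ /=.
  by rewrite theadE; congr (_, _); apply: val_inj.
by rewrite /h -tuple_eta.
Qed.

Variables (Sigma : finType) (r : nat).

(** The guarded product over [a] selects the letter of [w] at [i] without a default letter, as
    [Sigma] may be empty; it also matches the monomial built later. *)
Definition path_weight (A : weighted_automaton S Sigma r) (w : seq Sigma)
    (s : (size w).+1.-tuple 'I_r) : S :=
  wa_initial A ord0 (tnth s ord0) *
  (\prod_(i < size w) \prod_(a | nth a w i == a)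
     wa_matrix A a (tnth s (widen_ord (leqnSn _) i)) (tnth s (lift ord0 i))) *
  wa_final A ord0 (tnth s ord_max).

Lemma wa_fun_paths (A : weighted_automaton S Sigma r) (w : seq Sigma) :
  wa_fun A w = \sum_s path_weight A (w := w) s.
Proof.
(* The start state [q] is general for the induction; the default [d] is never reached. *)
have runE d q :
    ((\big[mulmx/1%:M]_(a <- w) wa_matrix A a) *m (wa_final A)^T) q ord0 =
    \sum_(u : (size w).-tuple 'I_r)
      (\prod_(i < size w) \prod_(a | nth a w i == a)
         wa_matrix A a (nth d (q :: u) i) (nth d u i)) *
      wa_final A ord0 (last q u).
  elim: w q => [|b w IHw] q.
    rewrite big_nil mul1mx mxE (big_pred1 [tuple]) /=.
      by rewrite big_ord0 mul1r.
    by move=> u /=; apply/esym/eqP; rewrite (tuple0 u).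
  rewrite big_cons -mulmxA mxE sum_tuple_cons; apply: eq_bigr => p _.
  rewrite IHw big_distrr; apply: eq_bigr => u _ /=.
  rewrite big_ord_recl (big_pred1 b) => [|a]; last by rewrite /= eq_sym.
  by rewrite /= mulrA.
rewrite /wa_fun -mulmxA mxE sum_tuple_cons; apply: eq_bigr => q _.
rewrite (runE q) big_distrr; apply: eq_bigr => u _ /=.
rewrite /path_weight tnth0 mulrA.
congr (_ * _ * _); first last.
  by rewrite (last_nth q) (tnth_nth q) /= size_tuple.
apply: eq_bigr => i _; apply: eq_bigr => a _.
by rewrite !(tnth_nth q).
Qed.

End AutomatonPaths.

(** * Formulas for local shapes of positions *)

Section Formulas.

Variable tau : finType.

(** At least one first-order variable is required, because the empty conjunction is the tautology
    [x = x]. *)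
Definition mbigand n k (I : Type) (l : seq I) (F : I -> msol tau n.+1 k) :
    msol tau n.+1 k :=
  foldr (fun i phi => MAnd (F i) phi) (MEq tau k ord0 ord0) l.

Lemma sat_bigand (A : structure tau) n k (I : Type) (l : seq I)
    (F : I -> msol tau n.+1 k) e E :
  sat A (mbigand l F) e E = all (fun i => sat A (F i) e E) l.
Proof. by elim: l => /= [|i l ->]; rewrite ?eqxx. Qed.

Definition mbigor n k (I : Type) (l : seq I) (F : I -> msol tau n.+1 k) :
    msol tau n.+1 k :=
  MNot (mbigand l (fun i => MNot (F i))).

Lemma sat_bigor (A : structure tau) n k (I : Type) (l : seq I)
    (F : I -> msol tau n.+1 k) e E :
  sat A (mbigor l F) e E = has (fun i => sat A (F i) e E) l.
Proof.
by rewrite /= sat_bigand -has_predC; apply: eq_has => i /=; rewrite negbK.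
Qed.

Definition mfirst : msol tau 1 0 :=
  MNot (MEx1 (MLt tau 0 ord0 ord_max)).

Definition mlast : msol tau 1 0 :=
  MNot (MEx1 (MLt tau 0 ord_max ord0)).

(** The immediate predecessor of the free variable lies in [a]. In the inner scope the indices 0, 1,
    2 are the excluded intermediate point, the predecessor and the free variable. *)
Definition mpred (a : tau) : msol tau 1 0 :=
  MEx1 (MAnd (MPred 0 a ord0) (MAnd (MLt tau 0 ord0 ord_max)
    (MNot (MEx1 (MAnd (MLt tau 0 (lift ord0 ord0) ord0)
                      (MLt tau 0 ord0 ord_max)))))).

Variables (N : nat) (P : tau -> {set 'I_N.+1}).

Lemma sat_first v : sat (ord_struct P) mfirst [tuple v] [tuple] = (v == ord0).
Proof.
rewrite /= negb_exists; apply/forallP/eqP => [h|-> a //].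
apply/val_inj/eqP => /=; rewrite -leqn0 leqNgt.
exact: h ord0.
Qed.

Lemma sat_last v : sat (ord_struct P) mlast [tuple v] [tuple] = (v == ord_max).
Proof.
rewrite /= negb_exists; apply/forallP/eqP => [h|-> a /=].
  apply/val_inj/eqP => /=; rewrite eqn_leq -ltnS ltn_ord leqNgt /=.
  exact: h ord_max.
by rewrite -leqNgt -ltnS.
Qed.

Lemma sat_pred a v :
  sat (ord_struct P) (mpred a) [tuple v] [tuple] =
  [exists u : 'I_N.+1, (u \in P a) && (u.+1 == v :> nat)].
Proof.
apply: eq_existsb => u /=; congr (_ && _).
rewrite negb_exists; apply/andP/eqP => [[ltuv /forallP h]|eqv].
  apply/eqP; rewrite eqn_leq ltuv /= leqNgt; apply/negP => lt.
  (* Otherwise the position [u.+1] would lie strictly between [u] and [v]. *)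
  have /negP := h (Ordinal (ltn_trans lt (ltn_ord v))); apply.
  by rewrite /= ltnS leqnn.
split; first by rewrite /tnth /= -eqv.
apply/forallP => z; rewrite /tnth /= -eqv ltnS.
by apply/negP => /andP [h1 h2]; move: (leq_trans h1 h2); rewrite ltnn.
Qed.

End Formulas.

Section Monomials.

Variables (S : comPzSemiRingType) (tau : finType).

(* Zero is not an admissible constant; it is the value of an indeterminate. *)
Definition coef_of (c : S) : coefficient S :=
  if insub c is Some x then Constant (valP (x : {x : S | x != 0}))
  else Indeterminate S 0.

Lemma eval_coef_of (c : S) : eval_coefficient (fun=> 0) (coef_of c) = c.
Proof.
by rewrite /coef_of; case: insubP => //=; rewrite negbK => /eqP.
Qed.

(** Monomials have no empty product; a power of 1 replaces it. *)
Definition mono_prod (l : seq (S * msol tau 1 0)) : monomial S tau :=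
  foldr (fun x m => MonoMul (MonoPow (coef_of x.1) x.2) m)
    (MonoPow (coef_of 1) (MEq tau 0 ord0 ord0)) l.

Lemma eval_mono_prod N (P : tau -> {set 'I_N}) (l : seq (S * msol tau 1 0)) :
  eval_monomial (fun=> 0) (ord_struct P) (mono_prod l) =
  \prod_(x <- l)
    \prod_(v : 'I_N | sat (ord_struct P) x.2 [tuple v] [tuple]) x.1.
Proof.
elim: l => [|x l IHl] /=; first by rewrite eval_coef_of expr1n big_nil.
rewrite big_cons IHl eval_coef_of -prodr_const; congr (_ * _).
by apply: eq_bigl => v; rewrite inE.
Qed.

End Monomials.

(** * The MSOL-polynomial of a weighted automaton *)

Section AutomatonPolynomial.

Variables (S : comPzSemiRingType) (Sigma : finType) (r : nat).
Variable A : weighted_automaton S Sigma r.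

Local Notation tau := (Sigma + 'I_r)%type.

Definition only_state (q : 'I_r) : msol tau 1 0 :=
  mbigand (enum 'I_r) (fun p =>
    let phi := MPred 0 (inr p : tau) ord0 in if p == q then phi else MNot phi).

Definition path_formula : msol tau 0 0 :=
  MNot (MEx1 (MNot (mbigor (enum 'I_r) only_state))).

(** The three groups count the first position, the transitions and the last position. A transition
    is counted at its target, which carries the letter read. *)
Definition path_monomial : monomial S tau :=
  mono_prod
    ([seq (wa_initial A ord0 q, MAnd (MPred 0 (inr q : tau) ord0) (mfirst tau))
       | q : 'I_r] ++
     [seq (wa_matrix A a pq.1 pq.2,
           MAnd (MPred 0 (inl a : tau) ord0)
             (MAnd (mpred (inr pq.1 : tau)) (MPred 0 (inr pq.2 : tau) ord0)))
       | a <- enum Sigma, pq <- enum {: 'I_r * 'I_r}] ++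
     [seq (wa_final A ord0 q, MAnd (MPred 0 (inr q : tau) ord0) (mlast tau))
       | q : 'I_r]).

Definition path_sets N (s : N.-tuple 'I_r) : r.-tuple {set 'I_N} :=
  [tuple [set v | tnth s v == q] | q < r].

Lemma path_sets_inj N : injective (@path_sets N).
Proof.
move=> s s' eqs; apply: eq_from_tnth => v; apply/eqP.
have /setP/(_ v) := congr1 (fun R => tnth R (tnth s' v)) eqs.
by rewrite !tnth_mktuple !inE eqxx.
Qed.

Lemma models_path_formula N (P : tau -> {set 'I_N}) :
  models (ord_struct P) path_formula =
  [forall v, exists q, forall p, (v \in P (inr p)) == (p == q)].
Proof.
rewrite /models /= negb_exists; apply: eq_forallb => v; rewrite negbK.
rewrite -[LHS]/(sat (ord_struct P) (mbigor (enum 'I_r) only_state)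
                 [tuple of v :: [tuple]] [tuple]) sat_bigor.
have onlyE q : sat (ord_struct P) (only_state q) [tuple of v :: [tuple]] [tuple]
    = [forall p, (v \in P (inr p)) == (p == q)].
  rewrite sat_bigand; apply/allP/forallP => h p.
    by have := h p (mem_enum _ _); case: (p == q) => /= [->|/negPf ->].
  by move=> _; have /eqP := h p; case: (p == q) => /= ->.
apply/hasP/existsP => [[q _]|[q hq]].
  by rewrite onlyE => hq; exists q.
by exists q; rewrite ?mem_enum ?onlyE.
Qed.

Definition path_structure (w : seq Sigma) (R : r.-tuple {set 'I_(size w).+1}) :
    structure tau :=
  expand (A := word_structure w) R.

(** The formula puts each position in exactly one set of [R]; the index of that set is the state of
    the path there. *)
Lemma models_path_sets (w : seq Sigma) (R : r.-tuple {set 'I_(size w).+1}) :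
  models (path_structure R) path_formula = (R \in (@path_sets _) @: setT).
Proof.
pose P := @unary_rel _ (path_structure R) : tau -> {set 'I_(size w).+1}.
rewrite -[path_structure R]/(ord_struct P) models_path_formula.
apply/forallP/imsetP => [h|[s _ eqR] v].
  have h' v : exists q, [forall p, (v \in tnth R p) == (p == q)].
    by have /existsP := h v.
  exists [tuple xchoose (h' v) | v < (size w).+1] => //.
  apply: eq_from_tnth => p; apply/setP => v.
  rewrite tnth_mktuple inE tnth_mktuple eq_sym.
  by have /forallP/(_ p)/eqP := xchooseP (h' v).
apply/existsP; exists (tnth s v); apply/forallP => p /=.
by rewrite /P /= eqR tnth_mktuple inE [p == _]eq_sym.
Qed.

Lemma prod_state_at N (s : N.-tuple 'I_r) (z : 'I_N) (F : 'I_r -> S) :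
  \prod_q \prod_(v | (tnth s v == q) && (v == z)) F q = F (tnth s z).
Proof.
rewrite (bigD1 (tnth s z)) //= (big_pred1 z) => [|v].
  rewrite big1 ?mulr1 // => q neq; rewrite big_pred0 // => v.
  by case: (v =P z) => [->|]; rewrite ?andbF // eq_sym (negPf neq).
by rewrite /=; case: (v =P z) => [->|]; rewrite ?eqxx ?andbF.
Qed.

Lemma eval_path_monomial (w : seq Sigma) (s : (size w).+1.-tuple 'I_r) :
  eval_monomial (fun=> 0) (path_structure (path_sets s)) path_monomial =
  path_weight A s.
Proof.
set R := path_sets s.
pose P := @unary_rel _ (path_structure R) : tau -> {set 'I_(size w).+1}.
have PE v q : (v \in P (inr q)) = (tnth s v == q).
  by rewrite /P /= tnth_mktuple inE.
rewrite -[path_structure R]/(ord_struct P) eval_mono_prod !big_cat /=.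
rewrite !big_map big_allpairs_dep !big_enum /= mulrA.
congr (_ * _ * _).
- rewrite -prod_state_at; apply: eq_bigr => q _; apply: eq_bigl => v.
  by rewrite -PE -(@sat_first _ _ P).
- under eq_bigr => a _ do rewrite big_enum /= (exchange_big_dep xpredT) //=.
  rewrite exchange_big /= big_ord_recl /= big1 ?mul1r => [|a _]; last first.
    by rewrite big_pred0 // => pq; rewrite /tnth /= inE.
  apply: eq_bigr => i _; rewrite [RHS]big_mkcond; apply: eq_bigr => a _.
  pose x := (tnth s (widen_ord (leqnSn _) i), tnth s (lift ord0 i)).
  have edgeE pq :
      sat (ord_struct P) (MAnd (MPred 0 (inl a : tau) ord0)
        (MAnd (mpred (inr pq.1 : tau)) (MPred 0 (inr pq.2 : tau) ord0)))
        [tuple lift ord0 i] [tuple] = (nth a w i == a) && (pq == x).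
    rewrite -[LHS]/[&& lift ord0 i \in P (inl a),
      sat (ord_struct P) (mpred (inr pq.1 : tau)) [tuple lift ord0 i] [tuple]
      & lift ord0 i \in P (inr pq.2)].
    rewrite sat_pred PE {1}/P /= inE /=; congr (_ && _).
    rewrite -pair_eqE /pair_eq /= [pq.2 == _]eq_sym; congr (_ && _).
    apply/existsP/eqP => [[u]|->].
      rewrite PE => /andP [/eqP <- /eqP [eqi]].
      by congr (tnth s _); apply: val_inj.
    by exists (widen_ord (leqnSn _) i); rewrite PE !eqxx.
  rewrite (eq_bigl _ _ edgeE); case: eqP => _; last by rewrite big_pred0.
  by rewrite (big_pred1 x).
- rewrite -prod_state_at; apply: eq_bigr => q _; apply: eq_bigl => v.
  by rewrite -PE -(@sat_last _ _ P).
Qed.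

End AutomatonPolynomial.

Lemma automaton_msoleval (S : comPzSemiRingType) (Sigma : finType)
    (f : seq Sigma -> S) (r : nat) (A : weighted_automaton S Sigma r) :
  recognized_by f A -> MSOLEVAL f.
Proof.
move=> fA; exists (PSum (path_formula Sigma r) (PMono (path_monomial A))).
exists (fun=> 0) => w; rewrite fA wa_fun_paths /=.
(* The sum over admissible tuples of sets is reindexed by paths, since [path_sets] is injective. The
   zero valuation realizes the zero coefficients. *)
rewrite (eq_bigl _ _ (@models_path_sets _ _ w)).
rewrite big_imset /=; last by move=> s s' _ _; apply: path_sets_inj.
by apply: eq_big => [s|s _]; rewrite ?inE // -eval_path_monomial.
Qed.

Theorem theorem8 (S : comPzSemiRingType) (Sigma : finType)
    (f : seq Sigma -> S) :
  MSOLEVAL f <->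
  exists (r : nat) (A : weighted_automaton S Sigma r), recognized_by f A.
Proof.
split; first exact: msoleval_automaton.
by move=> [r [A]]; apply: automaton_msoleval.
Qed.
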